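(* Suppose that $(A,B)$ is controllable and that $(C,A)$ and $(Q^{1/2},A)$ are observable. Suppose $X_{22}\succ0$ and $\mathsf K\in\mathbb{K}\cap\mathbb{K}_o$. If an optimal transformation matrix for $\mathsf K$ exists, i.e. a matrix $T^\star\in\mathrm{GL}_n$ with $J(\mathscr{T}_{T^\star}(\mathsf K))\le J(\mathscr{T}_T(\mathsf K))$ for all $T\in\mathrm{GL}_n$, then it is unique and is given by $$T^\star=-X_{22}X_{12}^{-1}P_{\mathsf K,12}^{-\mathsf T}P_{\mathsf K,22},$$ where $P_{\mathsf K}=\begin{bmatrix}P_{\mathsf K,11}&P_{\mathsf K,12}\\ P_{\mathsf K,12}^{\mathsf T}&P_{\mathsf K,22}\end{bmatrix}$ (blocks $n\times n$) is the unique positive definite solution of $$P_{\mathsf K}=\bar Q+\bar C^{\mathsf T}\mathsf K^{\mathsf T}\bar R\mathsf K\bar C+(\bar A+\bar B\mathsf K\bar C)^{\mathsf T}P_{\mathsf K}(\bar A+\bar B\mathsf K\bar C).$$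
   Context: Fix $A\in\mathbb{R}^{n\times n}$, $B\in\mathbb{R}^{n\times m}$, $C\in\mathbb{R}^{d\times n}$, $Q\in\mathbb{R}^{n\times n}$ symmetric positive semidefinite and $R\in\mathbb{R}^{m\times m}$ symmetric positive definite. The system is $x_{t+1}=Ax_t+Bu_t$, $y_t=Cx_t$, controlled by the full-order dynamic controller $\xi_{t+1}=A_{\mathsf K}\xi_t+B_{\mathsf K}y_t$, $u_t=C_{\mathsf K}\xi_t$, with $A_{\mathsf K}\in\mathbb{R}^{n\times n}$, $B_{\mathsf K}\in\mathbb{R}^{n\times d}$, $C_{\mathsf K}\in\mathbb{R}^{m\times n}$. Controller parameters are collected as $\mathsf K=\begin{bmatrix}0_{m\times d}&C_{\mathsf K}\\ B_{\mathsf K}&A_{\mathsf K}\end{bmatrix}$. Put $$\bar A=\begin{bmatrix}A&0\\ 0&0\end{bmatrix},\ \bar B=\begin{bmatrix}B&0\\ 0&I_n\end{bmatrix},\ \bar C=\begin{bmatrix}C&0\\ 0&I_n\end{bmatrix},\ \bar Q=\begin{bmatrix}Q&0\\ 0&0_{n\times n}\end{bmatrix},\ \bar R=\begin{bmatrix}R&0\\ 0&0_{n\times n}\end{bmatrix},$$ so that $\bar A+\bar B\mathsf K\bar C=\begin{bmatrix}A&BC_{\mathsf K}\\ B_{\mathsf K}C&A_{\mathsf K}\end{bmatrix}$ is the closed-loop matrix for $\bar x_t=(x_t,\xi_t)$. $\mathbb{K}$ is the set of $\mathsf K$ of the block form $\begin{bmatrix}0_{m\times d}&C_{\mathsf K}\\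 B_{\mathsf K}&A_{\mathsf K}\end{bmatrix}$ with spectral radius $\rho(\bar A+\bar B\mathsf K\bar C)<1$; $\mathbb{K}_o$ is the set of $\mathsf K$ of this block form with $(C_{\mathsf K},A_{\mathsf K})$ observable. The initial state $\bar x_0=(x_0,\xi_0)$ follows a fixed distribution $\bar{\mathcal D}$ (independent of $\mathsf K$) with finite second moments, and $X=\mathbb{E}_{\bar x_0\sim\bar{\mathcal D}}[\bar x_0\bar x_0^{\mathsf T}]=\begin{bmatrix}X_{11}&X_{12}\\ X_{12}^{\mathsf T}&X_{22}\end{bmatrix}$ with $n\times n$ blocks. The dLQR cost on $\mathbb{K}$ is $J(\mathsf K)=\mathbb{E}_{\bar x_0\sim\bar{\mathcal D}}\left[\sum_{t=0}^\infty (x_t^{\mathsf T}Qx_t+u_t^{\mathsf T}Ru_t)\right]=\mathrm{Tr}(P_{\mathsf K}X)$, where $P_{\mathsf K}$ is the unique positive semidefinite solution of the Lyapunov equation displayed in the claim. $\mathrm{GL}_n$ is the set of invertible real $n\times n$ matrices, and for $T\in\mathrm{GL}_n$ the similarity transformation of $\mathsf K$ is $\mathscr{T}_T(\mathsf K)=\begin{bmatrix}0&C_{\mathsf K}T^{-1}\\ TB_{\mathsf K}&TA_{\mathsf K}T^{-1}\end{bmatrix}$, which again lies in $\mathbb{K}$ when $\mathsf K\in\mathbb{K}$. The formula for $T^\star$ includes the assertion that $X_{12}$ and $P_{\mathsf K,12}$ are invertible when an optimal transformation exists. *)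

(* Defs.v *)
From HB Require Import structures.
From mathcomp Require Import all_boot all_order all_algebra.
From mathcomp Require Import all_classical all_reals all_analysis.
From mathcomp Require Import complex.

Set Implicit Arguments.
Unset Strict Implicit.
Unset Printing Implicit Defensive.

Import Order.TTheory GRing.Theory Num.Theory.
Import numFieldNormedType.Exports.

Local Open Scope classical_set_scope.
Local Open Scope ring_scope.

Definition quad (R : realType) (n : nat) (M : 'M[R]_n) (v : 'cV[R]_n) : R :=
  (v^T *m M *m v) 0 0.

Definition possemidef (R : realType) (n : nat) (M : 'M[R]_n) : Prop :=
  M^T = M /\ forall v : 'cV[R]_n, 0 <= quad M v.

Definition posdef (R : realType) (n : nat) (M : 'M[R]_n) : Prop :=
  M^T = M /\ forall v : 'cV[R]_n, v != 0 -> 0 < quad M v.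

(* The square root Q^{1/2}, i.e. the (unique) positive semidefinite S with
   S^2 = Q; the default value 0 is only taken when there is no such S, which
   does not happen for a positive semidefinite Q. *)
Definition psd_sqrt (R : realType) (n : nat) (Q : 'M[R]_n) : 'M[R]_n :=
  xget 0 [set S : 'M[R]_n | possemidef S /\ S *m S = Q].

(* Kalman rank conditions: the matrices are [B, AB, ..., A^(n-1)B] and
   the column of blocks C, CA, ..., CA^(n-1). *)
Definition controllable (R : realType) (n m : nat)
    (A : 'M[R]_n) (B : 'M[R]_(n, m)) : Prop :=
  \rank (\mxrow_(i < n) (A ^+ i *m B)) = n.

Definition observable (R : realType) (n d : nat)
    (C : 'M[R]_(d, n)) (A : 'M[R]_n) : Prop :=
  \rank (\mxcol_(i < n) (C *m A ^+ i)) = n.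

(* The spectrum is that of M seen as a complex matrix; `|l| lives in R[i] with
   zero imaginary part, hence complex.Re. *)
Definition spectral_radius (R : realType) (n : nat) (M : 'M[R]_n) : R :=
  sup [set complex.Re `|l| | l in
        [set l : R[i] | eigenvalue (map_mx (real_complex R) M) l]].

(* A controller is stored as K = [ D_K, C_K; B_K, A_K ]; the controllers of
   interest have D_K = 0. *)
Definition ctrlA (R : realType) (n m d : nat) (K : 'M[R]_(m + n, d + n)) :
  'M[R]_n := drsubmx K.
Definition ctrlB (R : realType) (n m d : nat) (K : 'M[R]_(m + n, d + n)) :
  'M[R]_(n, d) := dlsubmx K.
Definition ctrlC (R : realType) (n m d : nat) (K : 'M[R]_(m + n, d + n)) :
  'M[R]_(m, n) := ursubmx K.
Definition block_form (R : realType) (n m d : nat)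
  (K : 'M[R]_(m + n, d + n)) : Prop := ulsubmx K = 0.

Definition Abar (R : realType) (n : nat) (A : 'M[R]_n) : 'M[R]_(n + n) :=
  block_mx A 0 0 0.
Definition Bbar (R : realType) (n m : nat) (B : 'M[R]_(n, m)) :
  'M[R]_(n + n, m + n) := block_mx B 0 0 1%:M.
Definition Cbar (R : realType) (n d : nat) (C : 'M[R]_(d, n)) :
  'M[R]_(d + n, n + n) := block_mx C 0 0 1%:M.
Definition Qbar (R : realType) (n : nat) (Q : 'M[R]_n) : 'M[R]_(n + n) :=
  block_mx Q 0 0 0.
Definition Rbar (R : realType) (n m : nat) (Rc : 'M[R]_m) : 'M[R]_(m + n) :=
  block_mx Rc 0 0 0.

Definition closed_loop (R : realType) (n m d : nat) (A : 'M[R]_n)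
    (B : 'M[R]_(n, m)) (C : 'M[R]_(d, n)) (K : 'M[R]_(m + n, d + n)) :
  'M[R]_(n + n) := Abar A + Bbar B *m K *m Cbar C.

Definition stabilizing (R : realType) (n m d : nat) (A : 'M[R]_n)
    (B : 'M[R]_(n, m)) (C : 'M[R]_(d, n)) : set 'M[R]_(m + n, d + n) :=
  [set K | block_form K /\ spectral_radius (closed_loop A B C K) < 1].

Definition observable_ctrl (R : realType) (n m d : nat) :
    set 'M[R]_(m + n, d + n) :=
  [set K | block_form K /\ observable (ctrlC K) (ctrlA K)].

Definition lyapunov (R : realType) (n m d : nat) (A : 'M[R]_n)
    (B : 'M[R]_(n, m)) (C : 'M[R]_(d, n)) (Q : 'M[R]_n) (Rc : 'M[R]_m)
    (K : 'M[R]_(m + n, d + n)) (P : 'M[R]_(n + n)) : Prop :=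
  P = Qbar Q + (Cbar C)^T *m K^T *m Rbar n Rc *m K *m Cbar C
      + (closed_loop A B C K)^T *m P *m closed_loop A B C K.

(* The pair (x_t, xi_t) started at z = (x_0, xi_0), driven by
   u_t = C_K xi_t and y_t = C x_t. *)
Fixpoint traj (R : realType) (n m d : nat) (A : 'M[R]_n)
    (B : 'M[R]_(n, m)) (C : 'M[R]_(d, n)) (K : 'M[R]_(m + n, d + n))
    (z : 'cV[R]_(n + n)) (t : nat) : 'cV[R]_n * 'cV[R]_n :=
  if t is t'.+1 then
    let x := (traj A B C K z t').1 in
    let xi := (traj A B C K z t').2 in
    let u := ctrlC K *m xi in
    let y := C *m x in
    (A *m x + B *m u, ctrlA K *m xi + ctrlB K *m y)
  else (usubmx z, dsubmx z).

Definition stage_cost (R : realType) (n m d : nat) (A : 'M[R]_n)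
    (B : 'M[R]_(n, m)) (C : 'M[R]_(d, n)) (Q : 'M[R]_n) (Rc : 'M[R]_m)
    (K : 'M[R]_(m + n, d + n)) (z : 'cV[R]_(n + n)) (t : nat) : R :=
  quad Q (traj A B C K z t).1 + quad Rc (ctrlC K *m (traj A B C K z t).2).

(* The initial state is a random vector, given by its coordinates z0 i, which
   are real random variables on a common probability space; its distribution
   is their joint law. *)
Definition finite_second_moments (R : realType) (n : nat)
    (disp : measure_display) (Om : measurableType disp)
    (Pr : probability Om R) (z0 : 'I_n -> {RV Pr >-> R}) : Prop :=
  forall i, ('E_Pr[fun w => (z0 i w ^+ 2)%R] < +oo)%E.

Definition second_moment (R : realType) (n : nat)
    (disp : measure_display) (Om : measurableType disp)
    (Pr : probability Om R) (z0 : 'I_n -> {RV Pr >-> R}) : 'M[R]_n :=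
  \matrix_(i, j) fine ('E_Pr[fun w => (z0 i w * z0 j w)%R])%E.

(* The cost is defined for every K, with values in [0, +oo]. *)
Definition dLQR_cost (R : realType) (n m d : nat) (A : 'M[R]_n)
    (B : 'M[R]_(n, m)) (C : 'M[R]_(d, n)) (Q : 'M[R]_n) (Rc : 'M[R]_m)
    (disp : measure_display) (Om : measurableType disp)
    (Pr : probability Om R) (z0 : 'I_(n + n) -> {RV Pr >-> R})
    (K : 'M[R]_(m + n, d + n)) : \bar R :=
  (\int[Pr]_w
     \sum_(0 <= t <oo) (stage_cost A B C Q Rc K (\col_i z0 i w) t)%:E)%E.

Definition similarity (R : realType) (n m d : nat) (T : 'M[R]_n)
    (K : 'M[R]_(m + n, d + n)) : 'M[R]_(m + n, d + n) :=
  block_mx 0 (ctrlC K *m invmx T)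
           (T *m ctrlB K) (T *m ctrlA K *m invmx T).

Definition optimal_transformation (R : realType) (n m d : nat) (A : 'M[R]_n)
    (B : 'M[R]_(n, m)) (C : 'M[R]_(d, n)) (Q : 'M[R]_n) (Rc : 'M[R]_m)
    (disp : measure_display) (Om : measurableType disp)
    (Pr : probability Om R) (z0 : 'I_(n + n) -> {RV Pr >-> R})
    (K : 'M[R]_(m + n, d + n)) (T : 'M[R]_n) : Prop :=
  T \in unitmx /\
  forall T' : 'M[R]_n, T' \in unitmx ->
    (dLQR_cost A B C Q Rc z0 (similarity T K)
       <= dLQR_cost A B C Q Rc z0 (similarity T' K))%E.

(* Main.v *)
Require Import Defs.
From HB Require Import structures.
From mathcomp Require Import all_boot all_order all_algebra.
From mathcomp Require Import all_classical all_reals all_analysis.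
From mathcomp Require Import complex measurable_realfun ring.

(** Write [S] for the inverse of [T].  Changing the coordinates of the
    controller by [T] conjugates the closed loop by the block matrix
    [diag(I, S)], so the cost of the transformed controller is the cost of the
    original one started at [diag(I, S) z0]
    ([stage_cost_similarity]).  The closed loop of the original controller is
    stable, so its total cost from [z] is the quadratic form [z^T P z] of the
    Lyapunov solution ([cvg_sum_stage_cost]), and averaging over [z0], with
    second moments [X], gives the real-valued function
       [J(S) = \tr (diag(I, S)^T P diag(I, S) X)]
    ([dLQR_cost_similarity]).  This is a quadratic polynomial in [S]
    ([transformed_cost_expand]), whose gradient is twice
       [G(S) = P12^T X12 + P22 S X22].
    The invertible matrices form an open set, so [G] vanishes at an invertible
    minimizer ([cost_gradient_eq0]).  In [P12^T X12 = - P22 S X22] the right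
    side is invertible, because [P22] and [X22] are positive definite; hence
    [P12] and [X12] are invertible and the equation determines [T]
    ([critical_transformation]).  Every optimal transformation satisfies the
    same formula, which gives uniqueness.

    Two facts about the Lyapunov equation support this.

    It is uniquely solvable.  If the spectral radius of [M] is less than [1],
    then [M ^+ t] tends to [0]: the characteristic polynomial splits over the
    complex numbers and annihilates [M] (Cayley-Hamilton), and the factors
    [M - l] are peeled off one at a time, each of them being a scalar
    recurrence [w (t + 1) = l w t + g t] with [`|l| < 1]
    ([geometric_decay_recurrence]).  A solution of the homogeneous equation
    [P = M^T P M] equals [(M ^+ t)^T P (M ^+ t)] for every [t], hence is [0];
    an injective endomorphism of a finite-dimensional space is surjective.

    Its solution is positive definite.  If [z^T P z] is [0], all stage costs
    along the trajectory from [z] are [0].  Then [u] is identically [0] and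
    [Q^(1/2) A^t x_0 = 0] for all [t], so [x_0 = 0] by observability of the
    plant; the controller then runs without input and with zero output, so
    its initial state is [0] as well ([stage_cost_eq0]). *)

Set Implicit Arguments.
Unset Strict Implicit.
Unset Printing Implicit Defensive.

Import Order.TTheory GRing.Theory Num.Theory.
Import numFieldNormedType.Exports.

Local Open Scope classical_set_scope.
Local Open Scope ring_scope.

(** * Powers of a matrix of spectral radius less than one *)

(** The bounds [c] and [r] are elements of [F] itself, so that the same notion
    serves the complex numbers and their norm. *)
Definition geometric_decay (F : numFieldType) (w : nat -> F) : Prop :=
  exists c r : F, [/\ 0 <= c, 0 <= r, r < 1 & forall t, `|w t| <= c * r ^+ t].

(** Any rate [r] strictly between the maximum of [`|l|] and the rate of [g],
    and [1], works: the constant is chosen so that the forcing term is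
    absorbed by the gap [r - `|l|]. *)
Lemma geometric_decay_recurrence (F : numFieldType) (w g : nat -> F) (l : F) :
  `|l| < 1 -> (forall t, w t.+1 = l * w t + g t) ->
  geometric_decay g -> geometric_decay w.
Proof.
move=> l1 wS [c [q [c0 q0 q1 gle]]].
have [p [p1 lp qp]] : exists p : F, [/\ p < 1, `|l| <= p & q <= p].
  case: (real_leP (ger0_real (normr_ge0 l)) (ger0_real q0)) => [lq|/ltW ql].
    by exists q.
  by exists `|l|.
have [pr r1] : p < (p + 1) / 2 /\ (p + 1) / 2 < 1 by case: (midf_lt p1).
set r := (p + 1) / 2 in pr r1.
have lr : 0 < r - `|l| by rewrite subr_gt0 (le_lt_trans lp).
have r0 : 0 <= r by rewrite (le_trans q0) // (le_trans qp) // ltW.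
have k0 : 0 <= c / (r - `|l|) by rewrite divr_ge0 // ltW.
(* The constant satisfies [c <= (r - `|l|) * constant]. *)
exists (`|w 0%N| + c / (r - `|l|)), r; split=> //; first by rewrite addr_ge0.
elim=> [|t IH]; first by rewrite expr0 mulr1 lerDl.
rewrite wS (le_trans (ler_normD _ _)) // normrM.
have -> : (`|w 0%N| + c / (r - `|l|)) * r ^+ t.+1 =
   `|l| * ((`|w 0%N| + c / (r - `|l|)) * r ^+ t)
   + (r - `|l|) * (`|w 0%N| + c / (r - `|l|)) * r ^+ t.
  by rewrite exprS; ring.
apply: lerD; first by rewrite ler_wpM2l.
rewrite (le_trans (gle t)) // ler_pM ?exprn_ge0 //.
  rewrite mulrDr [X in _ + X]mulrC divfK ?gt_eqF //.
  by rewrite lerDr mulr_ge0 // ltW.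
by rewrite lerXn2r // ?nnegrE // (le_trans qp) // ltW.
Qed.

(** Induction on [s]: if [l] is the head of [s], then [N (M - l)] is
    annihilated by the remaining factors, and [N M^t] satisfies the scalar
    recurrence [w (t + 1) = l w t + g t] entrywise, where [g] is given by
    [N (M - l) M^t]. *)
Lemma geometric_decay_annihilated (F : numFieldType) (n : nat) (M : 'M[F]_n.+1)
    (s : seq F) (N : 'M[F]_n.+1) :
  (forall l, l \in s -> `|l| < 1) ->
  N *m \prod_(l <- s) (M - l%:M) = 0 ->
  forall i j, geometric_decay (fun t => (N *m M ^+ t) i j).
Proof.
elim: s N => [|l s IH] N sl1 N0 i j.
  exists 0, 0; split=> // t.
  rewrite big_nil mulmx1 in N0.
  by rewrite N0 mul0mx mxE normr0 mul0r.
have {}IH := IH (N *m (M - l%:M)).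
apply: (@geometric_decay_recurrence _ _
  (fun t => (N *m (M - l%:M) *m M ^+ t) i j) l).
- by apply: sl1; rewrite mem_head.
- move=> t; rewrite exprS mulmxBr mulmxBl mul_mx_scalar -scalemxAl.
  rewrite -[M * _]/(M *m _) mulmxA !mxE; ring.
apply: IH => [k ks|]; first by apply: sl1; rewrite in_cons ks orbT.
by rewrite -mulmxA -N0 big_cons.
Qed.

(** By Cayley-Hamilton, [M - l] over all roots [l] of the characteristic
    polynomial multiply to [0]. *)
Lemma geometric_decay_eigenvalues (F : numClosedFieldType) (n : nat)
    (M : 'M[F]_n) :
  (forall l, eigenvalue M l -> `|l| < 1) ->
  forall i j, geometric_decay (fun t => (M ^+ t) i j).
Proof.
case: n M => [|n] M Ml; first by case.
move=> i j.
have [s Ms] := closed_field_poly_normal (char_poly M).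
rewrite (monicP (char_poly_monic M)) scale1r in Ms.
have := @geometric_decay_annihilated F n M s 1%:M.
suff /[swap]/[apply] H : 1%:M *m \prod_(l <- s) (M - l%:M) = 0.
  have sl l : l \in s -> `|l| < 1.
    by move=> ls; apply: Ml; rewrite eigenvalue_root_char Ms root_prod_XsubC.
  have [c [r [c0 r0 r1 H']]] := H sl i j.
  by exists c, r; split=> // t; have := H' t; rewrite mul1mx.
rewrite mul1mx -[RHS](Cayley_Hamilton M) Ms rmorph_prod.
by apply: eq_bigr => l _; rewrite rmorphB /= horner_mx_X horner_mx_C.
Qed.

(** The supremum of an unbounded set is [0], so the point is that the spectrum
    is bounded: it is the set of roots of the characteristic polynomial, whose
    norms are at most their sum. *)
Lemma spectral_radius_ge (R : realType) (n : nat) (M : 'M[R]_n)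
    (l : complex.complex R) :
  eigenvalue (map_mx (complex.real_complex R) M) l ->
  complex.Re `|l| <= spectral_radius M.
Proof.
move=> Ml; apply: ub_le_sup; last by exists l.
set MC := map_mx _ M in Ml *.
have [s Ms] := closed_field_poly_normal (char_poly MC).
rewrite (monicP (char_poly_monic MC)) scale1r in Ms.
exists (\sum_(k <- s) complex.Re `|k|) => _ [k + <-].
rewrite /= eigenvalue_root_char Ms root_prod_XsubC => ks.
rewrite (big_rem k) //= lerDl sumr_ge0 // => a _.
by have := normr_ge0 a; rewrite complex.lecE => /andP[].
Qed.

Lemma map_mxX (aR rR : pzSemiRingType) (f : {rmorphism aR -> rR}) (n : nat)
    (M : 'M[aR]_n) (t : nat) :
  map_mx f (M ^+ t) = map_mx f M ^+ t.
Proof.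
elim: t => [|t IH]; first exact: map_mx1.
by rewrite !exprS -IH; exact: map_mxM.
Qed.

Lemma cvg_expmx_entry (R : realType) (n : nat) (M : 'M[R]_n) :
  spectral_radius M < 1 ->
  forall i j, (M ^+ t) i j @[t --> \oo] --> (0 : R).
Proof.
move=> M1 i j.
have Ml (l : complex.complex R) :
    eigenvalue (map_mx (complex.real_complex R) M) l -> `|l| < 1.
  move=> /spectral_radius_ge/le_lt_trans/(_ M1) l1.
  by rewrite complex.ltcE l1 andbT.
have [c [r [c0 r0 r1 Mle]]] := geometric_decay_eigenvalues Ml i j.
pose c' := complex.Re c; pose r' := complex.Re r.
(* A nonnegative complex number is real. *)
have ge0_real (x : complex.complex R) :
    0 <= x -> x = complex.real_complex R (complex.Re x).
  by rewrite complex.lecE => /andP[/eqP]; case: x => a b /= ->.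
have cE : c = complex.real_complex R c' by exact: ge0_real.
have rE : r = complex.real_complex R r' by exact: ge0_real.
have Mle' t : `|(M ^+ t) i j| <= geometric c' r' t.
  have := Mle t; rewrite -map_mxX mxE cE rE -rmorphXn -rmorphM /=.
  by rewrite complex.normc_def /= expr0n /= addr0 sqrtr_sqr complex.lecR.
apply: norm_cvg0.
apply: (@squeeze_cvgr _ _ _ _ (cst 0) (geometric c' r')).
- by apply: nearW => t; rewrite Mle' andbT normr_ge0.
- exact: cvg_cst.
- apply: cvg_geometric.
  by rewrite -complex.ltcR rE in r0 r1 *; rewrite ger0_norm // -complex.lecR.
Qed.

Definition mxcvg (R : realType) (m n : nat) (U : nat -> 'M[R]_(m, n))
    (L : 'M[R]_(m, n)) : Prop :=
  forall i j, U t i j @[t --> \oo] --> L i j.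

Lemma mxcvg_cst (R : realType) (m n : nat) (L : 'M[R]_(m, n)) :
  mxcvg (fun=> L) L.
Proof. by move=> i j; exact: cvg_cst. Qed.

Lemma mxcvg_tr (R : realType) (m n : nat) (U : nat -> 'M[R]_(m, n)) L :
  mxcvg U L -> mxcvg (fun t => (U t)^T) L^T.
Proof.
by move=> UL i j; rewrite mxE; under eq_fun do rewrite mxE; exact: UL.
Qed.

Lemma mxcvg_mul (R : realType) (m n p : nat) (U : nat -> 'M[R]_(m, n))
    (V : nat -> 'M[R]_(n, p)) L N :
  mxcvg U L -> mxcvg V N -> mxcvg (fun t => U t *m V t) (L *m N).
Proof.
move=> UL VN i j; rewrite mxE; under eq_fun do rewrite mxE.
apply: cvg_big => [|k _]; first exact: add_continuous.
by apply: cvgM; [exact: UL | exact: VN].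
Qed.

Lemma mxcvg_expmx (R : realType) (n : nat) (M : 'M[R]_n) :
  spectral_radius M < 1 -> mxcvg (fun t => M ^+ t) 0.
Proof. by move=> M1 i j; rewrite mxE; exact: (@cvg_expmx_entry _ _ M M1). Qed.

Lemma mxcvg_conj_expmx (R : realType) (n : nat) (M P : 'M[R]_n) :
  spectral_radius M < 1 -> mxcvg (fun t => (M ^+ t)^T *m P *m M ^+ t) 0.
Proof.
move=> /mxcvg_expmx Mcvg; rewrite -[0](mulmx0 _ (0^T *m P)).
by apply: mxcvg_mul => //; apply: mxcvg_mul;
  [exact: mxcvg_tr | exact: mxcvg_cst].
Qed.

(** * The discrete Lyapunov (Stein) equation *)

(** Iterating the equation gives [P = (M^t)^T P M^t] for all [t], and the
    right side tends to [0]. *)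
Lemma stein_eq0 (R : realType) (n : nat) (M P : 'M[R]_n) :
  spectral_radius M < 1 -> P = M^T *m P *m M -> P = 0.
Proof.
move=> M1 PM.
have Pt t : (M ^+ t)^T *m P *m M ^+ t = P.
  elim: t => [|t IH]; first by rewrite expr0 trmx1 mul1mx mulmx1.
  rewrite exprSr -[M ^+ t * M]/(M ^+ t *m M) trmx_mul.
  by rewrite -{2}IH in PM; rewrite [RHS]PM !mulmxA.
apply/matrixP => i j.
have := @mxcvg_conj_expmx _ _ M P M1 i j.
under eq_fun do rewrite Pt.
by move=> /(cvg_lim (@norm_hausdorff _ _)) <-; rewrite lim_cst.
Qed.

(** The map sending [P] to [P - M^T P M] is injective by [stein_eq0], hence
    bijective by finite dimension. *)
Lemma stein_solvable (R : realType) (n : nat) (M W : 'M[R]_n) :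
  spectral_radius M < 1 -> exists P, P = W + M^T *m P *m M.
Proof.
move=> M1.
pose L : {linear 'M[R]_n -> 'M[R]_n} := idfun \- (mulmxr M \o mulmx M^T).
have Lfree : row_free (lin_mx L).
  apply: inj_row_free => v; rewrite mul_rV_lin => /eqP.
  rewrite mxvec_eq0 subr_eq0 => /eqP /= /(stein_eq0 M1) v0.
  by rewrite -[v]vec_mxK v0 linear0.
have Lunit : lin_mx L \in unitmx by rewrite -row_free_unit.
exists (vec_mx (mxvec W *m invmx (lin_mx L))).
set P := vec_mx _.
have : L P = W by rewrite /P -mx_rV_lin mulmxKV // mxvecK.
by move=> <-; rewrite /= subrK.
Qed.

(** Telescoping: by the equation, [quad W y] is the loss of [quad P] in one
    step from [y] to [M y]. *)
Lemma quad_stein (R : realType) (n : nat) (M W P : 'M[R]_n) (v : 'cV[R]_n)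
    (N : nat) :
  P = W + M^T *m P *m M ->
  \sum_(0 <= t < N) quad W (M ^+ t *m v) =
  quad P v - quad ((M ^+ N)^T *m P *m M ^+ N) v.
Proof.
move=> PE; elim: N => [|N IH].
  by rewrite big_nil expr0 trmx1 mul1mx mulmx1 subrr.
rewrite big_nat_recr //= {}IH -addrA; congr (_ + _).
rewrite exprS -[M * _]/(M *m _) trmx_mul.
rewrite /quad {1}PE !trmx_mul !(mulmxDr, mulmxDl) !mulmxA !mxE; ring.
Qed.

Lemma cvg_quad (R : realType) (n : nat) (U : nat -> 'M[R]_n) L (v : 'cV[R]_n) :
  mxcvg U L -> quad (U t) v @[t --> \oo] --> quad L v.
Proof.
move=> UL; have : mxcvg (fun t => v^T *m U t *m v) (v^T *m L *m v).
  apply: mxcvg_mul; last exact: mxcvg_cst.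
  by apply: mxcvg_mul => //; exact: mxcvg_cst.
exact.
Qed.

Lemma cvg_sum_quad_stein (R : realType) (n : nat) (M W P : 'M[R]_n)
    (v : 'cV[R]_n) :
  spectral_radius M < 1 -> P = W + M^T *m P *m M ->
  \sum_(0 <= t < N) quad W (M ^+ t *m v) @[N --> \oo] --> quad P v.
Proof.
move=> M1 PE; under eq_fun do rewrite (quad_stein _ _ PE).
have /(@cvg_quad _ _ _ _ v) := @mxcvg_conj_expmx _ _ M P M1.
rewrite {2}/quad mulmx0 mul0mx mxE => H.
have Pc : quad P v @[t --> \oo] --> quad P v by exact: cvg_cst.
have H2 := cvgB Pc H; rewrite subr0 in H2; exact: H2.
Qed.

(** * The closed loop and its cost *)

(** The matrix of the stage cost, as a quadratic form in the pair of the plant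
    state and the controller state. *)
Definition stage_weight (R : realType) (n m d : nat) (C : 'M[R]_(d, n))
    (Q : 'M[R]_n) (Rc : 'M[R]_m) (K : 'M[R]_(m + n, d + n)) : 'M[R]_(n + n) :=
  Qbar Q + (Cbar C)^T *m K^T *m Rbar n Rc *m K *m Cbar C.

Lemma block_formE (R : realType) (n m d : nat) (K : 'M[R]_(m + n, d + n)) :
  block_form K -> K = block_mx 0 (ctrlC K) (ctrlB K) (ctrlA K).
Proof. by rewrite -[K in LHS]submxK /block_form => ->. Qed.

Lemma closed_loop_block (R : realType) (n m d : nat) (A : 'M[R]_n)
    (B : 'M[R]_(n, m)) (C : 'M[R]_(d, n)) (K : 'M[R]_(m + n, d + n)) :
  block_form K ->
  closed_loop A B C K =
  block_mx A (B *m ctrlC K) (ctrlB K *m C) (ctrlA K).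
Proof.
move=> /block_formE KE; rewrite /closed_loop /Abar /Bbar /Cbar {1}KE.
rewrite !mulmx_block add_block_mx.
by rewrite !(mulmx0, mul0mx, mulmx1, mul1mx, addr0, add0r).
Qed.

Lemma stage_weight_block (R : realType) (n m d : nat) (C : 'M[R]_(d, n))
    (Q : 'M[R]_n) (Rc : 'M[R]_m) (K : 'M[R]_(m + n, d + n)) :
  block_form K ->
  stage_weight C Q Rc K = block_mx Q 0 0 ((ctrlC K)^T *m Rc *m ctrlC K).
Proof.
move=> /block_formE KE; rewrite /stage_weight /Qbar /Cbar /Rbar {1 2}KE.
rewrite !tr_block_mx !mulmx_block add_block_mx.
by rewrite !(trmx0, trmx1, mulmx0, mul0mx, mulmx1, mul1mx, addr0, add0r).
Qed.

Lemma traj_expmx (R : realType) (n m d : nat) (A : 'M[R]_n)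
    (B : 'M[R]_(n, m)) (C : 'M[R]_(d, n)) (K : 'M[R]_(m + n, d + n))
    (z : 'cV[R]_(n + n)) (t : nat) :
  block_form K ->
  col_mx (traj A B C K z t).1 (traj A B C K z t).2 =
  closed_loop A B C K ^+ t *m z.
Proof.
move=> bK; elim: t => [|t IH]; first by rewrite expr0 mul1mx vsubmxK.
rewrite exprS -[_ * _]/(_ *m _) -mulmxA -IH closed_loop_block //=.
by rewrite mul_block_col !mulmxA [X in col_mx _ X]addrC.
Qed.

Lemma quad_block_diag (R : realType) (n m : nat) (U : 'M[R]_n) (V : 'M[R]_m)
    (x : 'cV[R]_n) (y : 'cV[R]_m) :
  quad (block_mx U 0 0 V) (col_mx x y) = quad U x + quad V y.
Proof.
rewrite /quad tr_col_mx mul_row_block mul_row_col.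
by rewrite !(mulmx0, addr0, add0r) mxE.
Qed.

Lemma quad_congr (R : realType) (n m : nat) (N : 'M[R]_m) (E : 'M[R]_(m, n))
    (v : 'cV[R]_n) :
  quad (E^T *m N *m E) v = quad N (E *m v).
Proof. by rewrite /quad trmx_mul !mulmxA. Qed.

Lemma stage_cost_quad (R : realType) (n m d : nat) (A : 'M[R]_n)
    (B : 'M[R]_(n, m)) (C : 'M[R]_(d, n)) (Q : 'M[R]_n) (Rc : 'M[R]_m)
    (K : 'M[R]_(m + n, d + n)) (z : 'cV[R]_(n + n)) (t : nat) :
  block_form K ->
  stage_cost A B C Q Rc K z t =
  quad (stage_weight C Q Rc K) (closed_loop A B C K ^+ t *m z).
Proof.
move=> bK; rewrite -traj_expmx // stage_weight_block // quad_block_diag.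
by rewrite quad_congr.
Qed.

(** * Positive definiteness of the Lyapunov solution *)

Lemma mul_colv_tr_eq0 (R : realType) (n : nat) (v : 'cV[R]_n) :
  (v^T *m v) 0 0 = 0 -> v = 0.
Proof.
rewrite mxE => v0; apply/colP => i; rewrite [RHS]mxE.
have sq_ge0 j : true -> 0 <= v^T 0 j * v j 0 by rewrite mxE -expr2 sqr_ge0.
have /eqP := @psumr_eq0P _ _ _ _ sq_ge0 v0 i isT.
by rewrite mxE mulf_eq0 orbb => /eqP.
Qed.

(** If [S] is the square root, [quad Q x] is the squared length of [S x]; the
    default value [0] of [psd_sqrt] satisfies the conclusion trivially. *)
Lemma psd_sqrt_mul_eq0 (R : realType) (n : nat) (Q : 'M[R]_n) (x : 'cV[R]_n) :
  quad Q x = 0 -> psd_sqrt Q *m x = 0.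
Proof.
rewrite /psd_sqrt; case: xgetP => [S _ [[Ssym _] <-]|_ _]; last first.
  by rewrite mul0mx.
rewrite -{1}Ssym -[S^T *m S]mulmx1 => H.
apply: mul_colv_tr_eq0; move: H.
by rewrite /quad trmx_mul mulmx1 !mulmxA.
Qed.

Lemma posdef_quad_eq0 (R : realType) (n : nat) (N : 'M[R]_n) (x : 'cV[R]_n) :
  posdef N -> quad N x = 0 -> x = 0.
Proof.
by move=> [_ N0] x0; apply/eqP/negPn/negP => /N0; rewrite x0 ltxx.
Qed.

Lemma posdef_ge0 (R : realType) (n : nat) (N : 'M[R]_n) (x : 'cV[R]_n) :
  posdef N -> 0 <= quad N x.
Proof.
move=> [_ N0]; have [->|/N0/ltW//] := eqVneq x 0.
by rewrite /quad mulmx0 mxE.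
Qed.

Lemma observable_eq0 (R : realType) (n d : nat) (C : 'M[R]_(d, n))
    (A : 'M[R]_n) (x : 'cV[R]_n) :
  observable C A -> (forall t, C *m A ^+ t *m x = 0) -> x = 0.
Proof.
move=> obs Cx; pose O := \mxcol_(i < n) (C *m A ^+ i).
have Ofree : row_free O^T by rewrite /row_free mxrank_tr; apply/eqP.
apply: trmx_inj; apply: (row_free_inj Ofree).
rewrite -trmx_mul trmx0 mul0mx mxcol_mul.
have -> : \mxcol_(i < n) (C *m A ^+ i *m x) = 0.
  by rewrite -(mxcol0 1); apply/eq_mxcolP => i; exact: Cx.
by rewrite trmx0.
Qed.

Lemma stage_cost_ge0 (R : realType) (n m d : nat) (A : 'M[R]_n)
    (B : 'M[R]_(n, m)) (C : 'M[R]_(d, n)) (Q : 'M[R]_n) (Rc : 'M[R]_m)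
    (K : 'M[R]_(m + n, d + n)) (z : 'cV[R]_(n + n)) (t : nat) :
  possemidef Q -> posdef Rc -> 0 <= stage_cost A B C Q Rc K z t.
Proof. by move=> [_ Q0] Rc0; rewrite addr_ge0 // posdef_ge0. Qed.

(** Zero stage costs mean that the control [u] vanishes and that the plant
    runs freely with [Q^(1/2) x_t = 0]; observability gives [x_0 = 0].  The
    controller then receives no input, and observability of
    [(ctrlC K, ctrlA K)] applies to it. *)
Lemma stage_cost_eq0 (R : realType) (n m d : nat) (A : 'M[R]_n)
    (B : 'M[R]_(n, m)) (C : 'M[R]_(d, n)) (Q : 'M[R]_n) (Rc : 'M[R]_m)
    (K : 'M[R]_(m + n, d + n)) (z : 'cV[R]_(n + n)) :
  possemidef Q -> posdef Rc ->
  observable (psd_sqrt Q) A -> observable (ctrlC K) (ctrlA K) ->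
  (forall t, stage_cost A B C Q Rc K z t = 0) -> z = 0.
Proof.
move=> [Qsym Q0] Rc0 obsA obsK z0.
pose x t := (traj A B C K z t).1; pose xi t := (traj A B C K z t).2.
have Qx t : quad Q (x t) = 0 /\ quad Rc (ctrlC K *m xi t) = 0.
  have /eqP := z0 t; rewrite paddr_eq0 ?Q0 ?posdef_ge0 //.
  by move=> /andP[/eqP ? /eqP].
have u0 t : ctrlC K *m xi t = 0 by apply: posdef_quad_eq0 Rc0 _; case: (Qx t).
have xE t : x t = A ^+ t *m x 0%N.
  elim: t => [|t IH]; first by rewrite expr0 mul1mx.
  rewrite exprS -[A * _]/(A *m _) -mulmxA -IH /x /=.
  by rewrite -/(xi t) u0 mulmx0 addr0.
have x0 : x 0%N = 0.
  apply: observable_eq0 obsA _ => t; rewrite -mulmxA -xE.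
  by apply: psd_sqrt_mul_eq0; case: (Qx t).
have xiE t : xi t = ctrlA K ^+ t *m xi 0%N.
  elim: t => [|t IH]; first by rewrite expr0 mul1mx.
  rewrite exprS -[ctrlA K * _]/(ctrlA K *m _) -mulmxA -IH /xi /=.
  by rewrite -/(x t) xE x0 !mulmx0 addr0.
have xi0 : xi 0%N = 0.
  by apply: observable_eq0 obsK _ => t; rewrite -mulmxA -xiE u0.
by rewrite -[z]vsubmxK -[usubmx z]/(x 0%N) -[dsubmx z]/(xi 0%N) x0 xi0 col_mx0.
Qed.

Lemma cvg_sum_stage_cost (R : realType) (n m d : nat) (A : 'M[R]_n)
    (B : 'M[R]_(n, m)) (C : 'M[R]_(d, n)) (Q : 'M[R]_n) (Rc : 'M[R]_m)
    (K : 'M[R]_(m + n, d + n)) (P : 'M[R]_(n + n)) (z : 'cV[R]_(n + n)) :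
  stabilizing A B C K -> lyapunov A B C Q Rc K P ->
  \sum_(0 <= t < N) stage_cost A B C Q Rc K z t @[N --> \oo] --> quad P z.
Proof.
move=> [bK M1] PE.
have := @cvg_sum_quad_stein _ _ _ (stage_weight C Q Rc K) P z M1 PE.
by under eq_fun do under eq_bigr do rewrite -stage_cost_quad //.
Qed.

(** The difference of two solutions solves the homogeneous equation.  This also
    makes the solution symmetric, because its transpose is a solution. *)
Lemma lyapunov_uniq (R : realType) (n m d : nat) (A : 'M[R]_n)
    (B : 'M[R]_(n, m)) (C : 'M[R]_(d, n)) (Q : 'M[R]_n) (Rc : 'M[R]_m)
    (K : 'M[R]_(m + n, d + n)) (P P' : 'M[R]_(n + n)) :
  stabilizing A B C K -> lyapunov A B C Q Rc K P ->
  lyapunov A B C Q Rc K P' -> P' = P.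
Proof.
move=> [_ M1] PE P'E; apply/eqP; rewrite -subr_eq0; apply/eqP.
apply: (stein_eq0 M1).
by rewrite {1}PE {1}P'E opprD addrACA subrr add0r mulmxBr mulmxBl.
Qed.

(** [quad P z] is the sum of the nonnegative stage costs from [z], so it
    dominates each of them. *)
Lemma lyapunov_posdef (R : realType) (n m d : nat) (A : 'M[R]_n)
    (B : 'M[R]_(n, m)) (C : 'M[R]_(d, n)) (Q : 'M[R]_n) (Rc : 'M[R]_m)
    (K : 'M[R]_(m + n, d + n)) (P : 'M[R]_(n + n)) :
  possemidef Q -> posdef Rc ->
  observable (psd_sqrt Q) A -> observable (ctrlC K) (ctrlA K) ->
  stabilizing A B C K -> lyapunov A B C Q Rc K P -> posdef P.
Proof.
move=> Qpsd Rpd obsA obsK stK PE; split.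
  have [Qsym _] := Qpsd; have [Rsym _] := Rpd.
  have QbarT : (Qbar Q)^T = Qbar Q by rewrite tr_block_mx !trmx0 Qsym.
  have RbarT : (Rbar n Rc)^T = Rbar n Rc by rewrite tr_block_mx !trmx0 Rsym.
  apply: (lyapunov_uniq stK PE); rewrite /lyapunov {1}PE.
  move: (closed_loop A B C K) => M.
  by rewrite !linearD /= !trmx_mul QbarT RbarT !trmxK !mulmxA.
move=> z z0; have cost := @cvg_sum_stage_cost _ _ _ _ _ _ _ _ _ _ _ z stK PE.
have c0 t := @stage_cost_ge0 _ _ _ _ A B C Q Rc K z t Qpsd Rpd.
have mono : nondecreasing_seq
    (fun N => \sum_(0 <= t < N) stage_cost A B C Q Rc K z t).
  by apply/nondecreasing_seqP => N; rewrite big_nat_recr //= lerDl.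
have le_cost t : stage_cost A B C Q Rc K z t <= quad P z.
  rewrite -(cvg_lim (@norm_hausdorff _ _) cost).
  apply: le_trans (nondecreasing_cvgn_le mono _ t.+1); last first.
    by apply/cvg_ex; exists (quad P z).
  by rewrite big_nat_recr //= lerDr sumr_ge0.
rewrite lt_neqAle (le_trans (c0 0%N)) // andbT.
apply: contra_neq z0 => Pz.
apply: (stage_cost_eq0 (B := B) (C := C) Qpsd Rpd obsA obsK) => t.
by apply/le_anti; rewrite c0 Pz le_cost.
Qed.

(** * The cost of a similar controller *)

(** For [S] the inverse of [T], this maps initial states for the controller
    transformed by [T] to initial states for the original one. *)
Definition state_change (R : realType) (n : nat) (S : 'M[R]_n) :
  'M[R]_(n + n) :=
  block_mx 1%:M 0 0 S.

Lemma traj_similarity (R : realType) (n m d : nat) (A : 'M[R]_n)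
    (B : 'M[R]_(n, m)) (C : 'M[R]_(d, n)) (K : 'M[R]_(m + n, d + n))
    (T : 'M[R]_n) (z : 'cV[R]_(n + n)) (t : nat) :
  T \in unitmx ->
  let y := state_change (invmx T) *m z in
  traj A B C (similarity T K) z t =
  ((traj A B C K y t).1, T *m (traj A B C K y t).2).
Proof.
move=> Tu y.
have yE : y = col_mx (usubmx z) (invmx T *m dsubmx z).
  rewrite /y -{1}[z]vsubmxK mul_block_col.
  by rewrite !(mul1mx, mul0mx, addr0, add0r).
elim: t => [|t IH]; first by rewrite /= yE col_mxKu col_mxKd mulKVmx.
rewrite [LHS]/= {}IH /= /ctrlA /ctrlB /ctrlC /similarity.
rewrite block_mxKur block_mxKdl block_mxKdr.
by rewrite mulmxDr -!mulmxA !(mulKmx Tu).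
Qed.

Lemma stage_cost_similarity (R : realType) (n m d : nat) (A : 'M[R]_n)
    (B : 'M[R]_(n, m)) (C : 'M[R]_(d, n)) (Q : 'M[R]_n) (Rc : 'M[R]_m)
    (K : 'M[R]_(m + n, d + n)) (T : 'M[R]_n) (z : 'cV[R]_(n + n)) (t : nat) :
  T \in unitmx ->
  stage_cost A B C Q Rc (similarity T K) z t =
  stage_cost A B C Q Rc K (state_change (invmx T) *m z) t.
Proof.
move=> Tu; rewrite /stage_cost traj_similarity //=.
by rewrite /ctrlC block_mxKur -mulmxA mulKmx.
Qed.

(** Products are dominated by [z_i^2 + z_j^2]. *)
Lemma integrable_second_moment (R : realType) (n : nat)
    (disp : measure_display) (Om : measurableType disp)
    (Pr : probability Om R) (z0 : 'I_n -> {RV Pr >-> R}) (i j : 'I_n) :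
  finite_second_moments z0 ->
  Pr.-integrable setT (fun w => (z0 i w * z0 j w)%:E).
Proof.
move=> z0_L2.
have sq k : Pr.-integrable setT (fun w => (z0 k w ^+ 2)%:E).
  apply/integrableP; split.
    by apply/measurable_EFinP; exact: measurable_funX.
  have := z0_L2 k; rewrite unlock; apply: le_lt_trans.
  rewrite le_eqVlt; apply/orP; left; apply/eqP.
  by apply: eq_integral => w _; rewrite gee0_abs // lee_fin sqr_ge0.
apply: le_integrable (integrableD _ (sq i) (sq j)) => //.
  by apply/measurable_EFinP; exact: measurable_funM.
move=> w _; rewrite -EFinD !abse_EFin lee_fin.
rewrite [leRHS]ger0_norm ?addr_ge0 ?sqr_ge0 // normrM.
have := (leif_mean_square_scaled `|z0 i w| `|z0 j w|).1.
rewrite !real_normK ?num_real //; apply: le_trans.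
by rewrite mulr2n lerDl mulr_ge0.
Qed.

Lemma second_moment_sym (R : realType) (n : nat)
    (disp : measure_display) (Om : measurableType disp)
    (Pr : probability Om R) (z0 : 'I_n -> {RV Pr >-> R}) :
  (second_moment z0)^T = second_moment z0.
Proof.
apply/matrixP => i j; rewrite !mxE; congr (fine 'E_Pr[_])%E.
by apply/funext => w; rewrite mulrC.
Qed.

Lemma integral_quad (R : realType) (n : nat)
    (disp : measure_display) (Om : measurableType disp)
    (Pr : probability Om R) (z0 : 'I_n -> {RV Pr >-> R}) (N : 'M[R]_n) :
  finite_second_moments z0 ->
  (\int[Pr]_w (quad N (\col_i z0 i w))%:E = (\tr (N *m second_moment z0))%:E)%E.
Proof.
move=> z0_L2.
have zz i j := @integrable_second_moment R n disp Om Pr z0 i j z0_L2.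
have quadE w : (quad N (\col_i z0 i w))%:E =
    (\sum_i \sum_j (N i j)%:E * (z0 j w * z0 i w)%:E)%E.
  rewrite /quad -mulmxA mxE -sumEFin; apply: eq_bigr => i _.
  rewrite !mxE mulr_sumr -sumEFin; apply: eq_bigr => j _.
  by rewrite mxE -EFinM; congr EFin; ring.
under eq_integral do rewrite quadE.
rewrite integral_sum //; last first.
  by move=> i; apply: integrable_sum => // j _; apply: integrableZl.
rewrite /mxtrace -sumEFin; apply: eq_bigr => i _.
rewrite integral_sum //; last by move=> j; exact: integrableZl.
rewrite mxE -sumEFin; apply: eq_bigr => j _.
rewrite integralZl // mxE EFinM fineK; first by rewrite unlock.
by rewrite unlock; exact: integrable_fin_num.
Qed.

(** The cost of the controller transformed by the inverse of [S]; in this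
    variable it is polynomial. *)
Definition transformed_cost (R : realType) (n : nat) (P X : 'M[R]_(n + n))
    (S : 'M[R]_n) : R :=
  \tr ((state_change S)^T *m P *m state_change S *m X).

(** The series is summed for each initial state, where it equals a quadratic
    form, and only then averaged; no interchange of limits is involved. *)
Lemma dLQR_cost_similarity (R : realType) (n m d : nat) (A : 'M[R]_n)
    (B : 'M[R]_(n, m)) (C : 'M[R]_(d, n)) (Q : 'M[R]_n) (Rc : 'M[R]_m)
    (disp : measure_display) (Om : measurableType disp)
    (Pr : probability Om R) (z0 : 'I_(n + n) -> {RV Pr >-> R})
    (K : 'M[R]_(m + n, d + n)) (P : 'M[R]_(n + n)) (T : 'M[R]_n) :
  finite_second_moments z0 -> stabilizing A B C K ->
  lyapunov A B C Q Rc K P -> T \in unitmx ->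
  dLQR_cost A B C Q Rc z0 (similarity T K) =
  (transformed_cost P (second_moment z0) (invmx T))%:E.
Proof.
move=> z0_L2 stK PE Tu; rewrite -integral_quad //.
apply: eq_integral => w _; rewrite quad_congr.
under eq_eseriesr do rewrite stage_cost_similarity //.
set y := state_change _ *m _.
apply/cvg_lim => //.
under eq_fun do rewrite sumEFin.
apply: cvg_EFin; first exact: nearW.
exact: (@cvg_sum_stage_cost _ _ _ _ _ _ _ _ _ _ _ y stK PE).
Qed.

(** * The first-order condition *)

(** This is half the gradient of [transformed_cost P X] at [S], for symmetric
    [P] and [X]. *)
Definition cost_gradient (R : realType) (n : nat) (P X : 'M[R]_(n + n))
    (S : 'M[R]_n) : 'M[R]_n :=
  (ursubmx P)^T *m ursubmx X + drsubmx P *m S *m drsubmx X.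

Lemma transformed_costE (R : realType) (n : nat) (P X : 'M[R]_(n + n))
    (S : 'M[R]_n) :
  P^T = P -> X^T = X ->
  transformed_cost P X S =
  \tr (ulsubmx P *m ulsubmx X) + \tr (S^T *m (ursubmx P)^T *m ursubmx X) *+ 2
  + \tr (S^T *m drsubmx P *m S *m drsubmx X).
Proof.
move=> Psym Xsym.
have Pdl : dlsubmx P = (ursubmx P)^T by rewrite trmx_ursub Psym.
have Xdl : dlsubmx X = (ursubmx X)^T by rewrite trmx_ursub Xsym.
rewrite /transformed_cost -{1}[P]submxK -{1}[X]submxK Pdl Xdl /state_change.
rewrite tr_block_mx !mulmx_block mxtrace_block.
rewrite !(trmx0, trmx1, mulmx0, mul0mx, mulmx1, mul1mx, addr0, add0r).
rewrite !mxtraceD -[\tr (_ *m S *m _)]mxtrace_tr !trmx_mul trmxK.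
by rewrite [\tr (ursubmx X *m _)]mxtrace_mulC mulr2n !addrA.
Qed.

(** The two cross terms in [S] and [H] are equal by symmetry of [P] and [X],
    whence the factor [2]. *)
Lemma transformed_cost_expand (R : realType) (n : nat) (P X : 'M[R]_(n + n))
    (S H : 'M[R]_n) (a : R) :
  P^T = P -> X^T = X ->
  transformed_cost P X (S + a *: H) =
  transformed_cost P X S + a * \tr (H^T *m cost_gradient P X S) *+ 2
  + a ^+ 2 * \tr (H^T *m drsubmx P *m H *m drsubmx X).
Proof.
move=> Psym Xsym.
have P22 : (drsubmx P)^T = drsubmx P by rewrite trmx_drsub Psym.
have X22 : (drsubmx X)^T = drsubmx X by rewrite trmx_drsub Xsym.
have cross : \tr (S^T *m drsubmx P *m H *m drsubmx X) =
    \tr (H^T *m drsubmx P *m S *m drsubmx X).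
  by rewrite -mxtrace_tr !trmx_mul P22 X22 trmxK mxtrace_mulC !mulmxA.
rewrite !transformed_costE // /cost_gradient.
rewrite !(linearD, linearZ) /= !(mulmxDl, mulmxDr).
rewrite -?(scalemxAl, scalemxAr) !mulmxDl -?scalemxAl.
rewrite !(mxtraceD, mxtraceZ) !mulmxA cross; ring.
Qed.

Lemma mxtrace_trmul_eq0 (R : realType) (n : nat) (G : 'M[R]_n) :
  \tr (G^T *m G) <= 0 -> G = 0.
Proof.
have sqG j : (G^T *m G) j j = \sum_i G i j ^+ 2.
  by rewrite mxE; apply: eq_bigr => i _; rewrite mxE.
have G0 j : true -> 0 <= (G^T *m G) j j.
  by rewrite sqG sumr_ge0 // => i _; rewrite sqr_ge0.
move=> G_le0; have G_eq0 : \tr (G^T *m G) = 0.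
  by apply/le_anti; rewrite G_le0 sumr_ge0.
apply/matrixP => i j; rewrite [RHS]mxE.
have := @psumr_eq0P _ _ _ _ G0 G_eq0 j isT.
rewrite sqG => /(@psumr_eq0P _ _ _ _ (fun i _ => sqr_ge0 _))/(_ i isT)/eqP.
by rewrite sqrf_eq0 => /eqP.
Qed.

(** The determinant of [S + a *: H] is a polynomial in [a], hence
    continuous. *)
Lemma unitmx_near (R : realType) (n : nat) (S H : 'M[R]_n) :
  S \in unitmx -> \forall a \near (0 : R), S + a *: H \in unitmx.
Proof.
move=> Su.
pose p := \det (map_mx polyC S + 'X *: map_mx polyC H).
have pE a : p.[a] = \det (S + a *: H).
  rewrite /p -[LHS]/(horner_eval a _) -det_map_mx; congr determinant.
  by apply/matrixP => i j; rewrite !mxE /= /horner_eval !hornerE.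
have p0 : p.[0] != 0 by rewrite pE scale0r addr0 -unitfE -unitmxE.
have : \forall a \near (0 : R), p.[a] != 0.
  have pc : p.[a] @[a --> (0 : R)] --> p.[0] by exact: continuous_horner.
  exact: (cvgr_neq0 _ pc p0).
by apply: filterS => a; rewrite pE -unitfE -unitmxE.
Qed.

(** Along the direction [- G] the cost is
    [J(S) - 2 a tr(G^T G) + a^2 k], which is smaller than [J(S)] for small
    positive [a] unless [G] is [0]. *)
Lemma cost_gradient_eq0 (R : realType) (n : nat) (P X : 'M[R]_(n + n))
    (S : 'M[R]_n) :
  P^T = P -> X^T = X -> S \in unitmx ->
  (forall S', S' \in unitmx ->
     transformed_cost P X S <= transformed_cost P X S') ->
  cost_gradient P X S = 0.
Proof.
move=> Psym Xsym Su Smin; set G := cost_gradient P X S.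
apply: mxtrace_trmul_eq0; set g := \tr _; rewrite leNgt; apply/negP => g0.
set k := \tr ((- G)^T *m drsubmx P *m (- G) *m drsubmx X).
have : \forall a \near (0 : R)^'+, a * k < g.
  have : a * k @[a --> (0 : R)^'+] --> 0 * k.
    by apply: cvgMr_tmp; exact/cvg_at_right_filter/cvg_id.
  by rewrite mul0r => /cvgr_lt; apply.
have : \forall a \near (0 : R)^'+, S + a *: (- G) \in unitmx.
  by apply: cvg_within; exact: unitmx_near.
have : \forall a \near (0 : R)^'+, 0 < a by exact: nbhs_right_gt.
move=> a0 aSu ak; have [] // : exists a,
    [/\ 0 < a, S + a *: (- G) \in unitmx & a * k < g].
  near (0 : R)^'+ => a; exists a; split; near: a => //.
move=> a [{}a0 /Smin + {}ak].
rewrite transformed_cost_expand // -/G -/k linearN /= mulNmx linearN /= -/g.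
rewrite -addrA lerDl leNgt => /negP; apply.
have -> : a * - g *+ 2 + a ^+ 2 * k = a * (a * k - g *+ 2) by ring.
by rewrite pmulr_rlt0 // subr_lt0 (lt_trans ak) // mulr2n ltrDl.
Unshelve. all: by end_near.
Qed.

(** The equation reads [P12^T X12 = - P22 T^-1 X22] with an invertible right
    side, so both factors on the left are invertible. *)
Lemma critical_transformation (R : realType) (n : nat) (P X : 'M[R]_(n + n))
    (T : 'M[R]_n) :
  T \in unitmx -> drsubmx P \in unitmx -> drsubmx X \in unitmx ->
  cost_gradient P X (invmx T) = 0 ->
  [/\ ursubmx X \in unitmx, ursubmx P \in unitmx &
    T = - (drsubmx X *m invmx (ursubmx X) *m (invmx (ursubmx P))^T
           *m drsubmx P)].
Proof.
rewrite /cost_gradient.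
move: (ursubmx P) (ursubmx X) (drsubmx P) (drsubmx X) => P12 X12 P22 X22.
move=> Tu P22u X22u /eqP; rewrite addr_eq0 => /eqP PX.
have /andP[P12u X12u] : (P12 \in unitmx) && (X12 \in unitmx).
  rewrite -[P12 \in _]unitmx_tr -unitmx_mul PX -scaleN1r unitmxZ ?unitrN1 //.
  by rewrite !unitmx_mul P22u X22u unitmx_inv Tu.
split=> //.
have -> : X22 = - (T *m invmx P22 *m P12^T *m X12).
  rewrite -!mulmxA PX -!mulmxN opprK -[P22 *m _ *m _]mulmxA mulKmx //.
  by rewrite mulKVmx.
rewrite !mulNmx opprK mulmxK // trmx_inv mulmxK ?unitmx_tr //.
by rewrite mulmxKV.
Qed.

Lemma posdef_unitmx (R : realType) (n : nat) (N : 'M[R]_n) :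
  posdef N -> N \in unitmx.
Proof.
move=> Npd; rewrite -row_free_unit; apply: inj_row_free => v vN.
apply: trmx_inj; rewrite trmx0; apply: (posdef_quad_eq0 Npd).
by rewrite /quad trmxK vN mul0mx mxE.
Qed.

Lemma posdef_drsubmx (R : realType) (n : nat) (P : 'M[R]_(n + n)) :
  posdef P -> posdef (drsubmx P).
Proof.
move=> [Psym P0]; split; first by rewrite trmx_drsub Psym.
move=> v v0; have := P0 (col_mx 0 v).
rewrite col_mx_eq0 (negPf v0) andbF => /(_ isT).
rewrite -{1}[P]submxK /quad tr_col_mx mul_row_block mul_row_col.
by rewrite !(trmx0, mul0mx, mulmx0, add0r).
Qed.

Theorem proposition2 (R : realType) (n m d : nat)
    (A : 'M[R]_n) (B : 'M[R]_(n, m)) (C : 'M[R]_(d, n))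
    (Q : 'M[R]_n) (Rc : 'M[R]_m)
    (disp : measure_display) (Om : measurableType disp)
    (Pr : probability Om R) (z0 : 'I_(n + n) -> {RV Pr >-> R})
    (K : 'M[R]_(m + n, d + n))
    (Q_psd : possemidef Q) (Rc_pd : posdef Rc)
    (z0_L2 : finite_second_moments z0)
    (AB_ctrl : controllable A B)
    (CA_obs : observable C A)
    (QA_obs : observable (psd_sqrt Q) A)
    (X22_pd : posdef (drsubmx (second_moment z0)))
    (K_in : (stabilizing A B C `&` @observable_ctrl R n m d) K) :
  let X12 : 'M[R]_n := ursubmx (second_moment z0) in
  let X22 : 'M[R]_n := drsubmx (second_moment z0) in
  exists P : 'M[R]_(n + n),
    [/\ posdef P,
        lyapunov A B C Q Rc K P,
        (forall P' : 'M[R]_(n + n),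
           posdef P' -> lyapunov A B C Q Rc K P' -> P' = P) &
        let P12 : 'M[R]_n := ursubmx P in
        let P22 : 'M[R]_n := drsubmx P in
        forall Tstar : 'M[R]_n,
          optimal_transformation A B C Q Rc z0 K Tstar ->
          [/\ (forall T : 'M[R]_n,
                 optimal_transformation A B C Q Rc z0 K T -> T = Tstar),
              X12 \in unitmx,
              P12 \in unitmx &
              Tstar = - (X22 *m invmx X12 *m (invmx P12)^T *m P22)]].
Proof.
move=> X12 X22; have [stK [_ obsK]] := K_in; have [_ M1] := stK.
have [P PE] := stein_solvable (stage_weight C Q Rc K) M1.
have Ppd : posdef P := lyapunov_posdef Q_psd Rc_pd QA_obs obsK stK PE.
exists P; split=> //; first by move=> P' _; exact: lyapunov_uniq.
move=> P12 P22 Tstar Topt.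
have optimalE T : optimal_transformation A B C Q Rc z0 K T ->
    [/\ X12 \in unitmx, P12 \in unitmx &
       T = - (X22 *m invmx X12 *m (invmx P12)^T *m P22)].
  move=> [Tu Tmin]; apply: critical_transformation => //.
  - exact/posdef_unitmx/posdef_drsubmx.
  - exact: posdef_unitmx.
  apply: cost_gradient_eq0; rewrite ?unitmx_inv //; first by case: Ppd.
    exact: second_moment_sym.
  move=> S Su; have Siu : invmx S \in unitmx by rewrite unitmx_inv.
  have := Tmin _ Siu.
  rewrite (dLQR_cost_similarity z0_L2 stK PE Tu).
  by rewrite (dLQR_cost_similarity z0_L2 stK PE Siu) invmxK lee_fin.
have [X12u P12u TE] := optimalE Tstar Topt.
by split=> // T /optimalE[_ _ ->].
Qed.
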